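(* Let $V$ be a subset of $\mathbb{R}^n$ and $W$ a subset of $\mathbb{R}^m$. Suppose that the quotient $\boldsymbol{T}$-algebra $\overline{\boldsymbol{T}(X_1,\ldots,X_n)}/\boldsymbol{E}(V)$ is isomorphic to $\overline{\boldsymbol{T}(Y_1,\ldots,Y_m)}/\boldsymbol{E}(W)$ as a $\boldsymbol{T}$-algebra. Then $\boldsymbol{E}(V)$ is finitely generated as a congruence if and only if $\boldsymbol{E}(W)$ is finitely generated as a congruence.
   Context: The tropical semifield is $\boldsymbol{T}=\mathbb{R}\cup\{-\infty\}$ with $a\oplus b=\max\{a,b\}$ and $a\odot b=a+b$ (and $a\oplus(-\infty)=a$, $a\odot(-\infty)=-\infty$); its zero is $-\infty$ and its one is $0$. $\boldsymbol{T}[X_1,\ldots,X_n]$ is the semiring of (formal) tropical polynomials. $\overline{\boldsymbol{T}[X_1,\ldots,X_n]}$ is its quotient identifying two tropical polynomials when they define the same function on $\boldsymbol{T}^n$; it is cancellative, and its semifield of fractions is the tropical rational function semifield $\overline{\boldsymbol{T}(X_1,\ldots,X_n)}$. An element $f\neq-\infty$ is of the form $f_1\odot f_2^{\odot(-1)}$ with $f_1,f_2\in\overline{\boldsymbol{T}[X_1,\ldots,X_n]}\setminus\{-\infty\}$ and defines a function $\mathbb{R}^n\to\mathbb{R}$, $f(x)=f_1(x)-f_2(x)$; the element $-\infty$ defines the constant function $-\infty$. A congruence on a semiring $S$ is a subset $E\subset S\times S$ that is an equivalence relation on $S$ and is closed under componentwise addition and multiplication; $S/E$ is the quotient semiring.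 It is finitely generated if it is the smallest congruence containing some finite subset of it. For $V\subset\mathbb{R}^n$, $\boldsymbol{E}(V)=\{(f,g)\in\overline{\boldsymbol{T}(X_1,\ldots,X_n)}^2 \mid f(x)=g(x)\text{ for all }x\in V\}$, and similarly for $W\subset\mathbb{R}^m$ with the variables $Y_1,\ldots,Y_m$. A $\boldsymbol{T}$-algebra is a (commutative) semiring $S$ with a semiring homomorphism $\boldsymbol{T}\to S$; here it is induced by the constants. A $\boldsymbol{T}$-algebra homomorphism is a semiring homomorphism (preserving zero and one) compatible with the maps from $\boldsymbol{T}$, and a $\boldsymbol{T}$-algebra isomorphism is a bijective one. *)

(* Defs.v *)
From HB Require Import structures.
From mathcomp Require Import all_boot all_order all_algebra.
From mathcomp Require Import boolp classical_sets cardinality reals.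
From mathcomp Require Import ring.

Set Implicit Arguments.
Unset Strict Implicit.
Unset Printing Implicit Defensive.

Import Order.TTheory GRing.Theory Num.Theory.

Local Open Scope ring_scope.
Local Open Scope quotient_scope.

Section Congruence.
Variable S : comPzSemiRingType.

Record is_congruence (E : set (S * S)) : Prop := IsCongruence {
  cong_refl : forall a, E (a, a);
  cong_sym : forall a b, E (a, b) -> E (b, a);
  cong_trans : forall a b c, E (a, b) -> E (b, c) -> E (a, c);
  congD : forall a b c d, E (a, b) -> E (c, d) -> E (a + c, b + d);
  congM : forall a b c d, E (a, b) -> E (c, d) -> E (a * c, b * d) }.

Record congruence := Congruence {
  cong_set :> set (S * S);
  congruenceP : is_congruence cong_set }.

Definition finitely_generated (E : set (S * S)) : Prop :=
  exists F : set (S * S),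
    [/\ finite_set F, (F `<=` E)%classic & E = smallest is_congruence F].

End Congruence.

Section Quotient.
Variables (S : comPzSemiRingType) (E : congruence S).

Definition cong_rel : rel S := fun a b => `[< cong_set E (a, b) >].

Lemma cong_rel_equiv : equiv_class_of cong_rel.
Proof.
have EP := congruenceP E.
split=> [a|a b|b a c].
- by apply/asboolP; apply: cong_refl.
- by apply/idP/idP => /asboolP h; apply/asboolP; apply: cong_sym.
- by move=> /asboolP h1 /asboolP h2; apply/asboolP; apply: (cong_trans EP) h2.
Qed.

Canonical cong_equiv := EquivRelPack cong_rel_equiv.
Canonical cong_encModRel := defaultEncModRel cong_rel.

Definition quot : Type := {eq_quot cong_rel}.
HB.instance Definition _ : EqQuotient S cong_rel quot := EqQuotient.on quot.
HB.instance Definition _ := Choice.on quot.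

Lemma quotP (a b : S) : \pi_quot a = \pi_quot b <-> cong_set E (a, b).
Proof.
split=> [/eqmodP/asboolP //|h].
by apply/eqmodP/asboolP.
Qed.

Lemma quot_ind (P : quot -> Prop) : (forall a, P (\pi_quot a)) -> forall u, P u.
Proof. by move=> h u; rewrite -[u]reprK. Qed.

Definition quot_zero : quot := \pi_quot 0.
Definition quot_one : quot := \pi_quot 1.
Definition quot_add (u v : quot) : quot := \pi_quot (repr u + repr v).
Definition quot_mul (u v : quot) : quot := \pi_quot (repr u * repr v).

Lemma quot_repr (a : S) : cong_set E (repr (\pi_quot a), a).
Proof. by apply/quotP; rewrite reprK. Qed.

Lemma quot_addE (a b : S) :
  quot_add (\pi_quot a) (\pi_quot b) = \pi_quot (a + b).
Proof. by apply/quotP; apply: congD (quot_repr a) (quot_repr b); case: E. Qed.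

Lemma quot_mulE (a b : S) :
  quot_mul (\pi_quot a) (\pi_quot b) = \pi_quot (a * b).
Proof. by apply/quotP; apply: congM (quot_repr a) (quot_repr b); case: E. Qed.

Lemma quot_addA : associative quot_add.
Proof. by elim/quot_ind=> a; elim/quot_ind=> b; elim/quot_ind=> c; rewrite !quot_addE addrA. Qed.
Lemma quot_addC : commutative quot_add.
Proof. by elim/quot_ind=> a; elim/quot_ind=> b; rewrite !quot_addE addrC. Qed.
Lemma quot_add0 : left_id quot_zero quot_add.
Proof. by elim/quot_ind=> a; rewrite !quot_addE add0r. Qed.

HB.instance Definition _ :=
  GRing.isNmodule.Build quot quot_addA quot_addC quot_add0.

Lemma quot_mulA : associative quot_mul.
Proof. by elim/quot_ind=> a; elim/quot_ind=> b; elim/quot_ind=> c; rewrite !quot_mulE mulrA. Qed.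
Lemma quot_mulC : commutative quot_mul.
Proof. by elim/quot_ind=> a; elim/quot_ind=> b; rewrite !quot_mulE mulrC. Qed.
Lemma quot_mul1 : left_id quot_one quot_mul.
Proof. by elim/quot_ind=> a; rewrite !quot_mulE mul1r. Qed.
Lemma quot_mulD : left_distributive quot_mul quot_add.
Proof.
by elim/quot_ind=> a; elim/quot_ind=> b; elim/quot_ind=> c;
   rewrite !(quot_mulE, quot_addE) mulrDl.
Qed.
Lemma quot_mul0 : left_zero quot_zero quot_mul.
Proof. by elim/quot_ind=> a; rewrite !quot_mulE mul0r. Qed.

HB.instance Definition _ := GRing.Nmodule_isComPzSemiRing.Build quot
  quot_mulA quot_mulC quot_mul1 quot_mulD quot_mul0.

Definition quot_proj (a : S) : quot := \pi_quot a.

Lemma quot_proj_nmod : nmod_morphism quot_proj.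
Proof. by split=> // a b; rewrite /quot_proj -quot_addE. Qed.
Lemma quot_proj_monoid : monoid_morphism quot_proj.
Proof. by split=> // a b; rewrite /quot_proj -quot_mulE. Qed.

HB.instance Definition _ :=
  GRing.isNmodMorphism.Build S quot quot_proj quot_proj_nmod.
HB.instance Definition _ :=
  GRing.isMonoidMorphism.Build S quot quot_proj quot_proj_monoid.

Lemma quot_projP (a b : S) : quot_proj a = quot_proj b <-> cong_set E (a, b).
Proof. exact: quotP. Qed.

Lemma quot_projW (P : quot -> Prop) : (forall a, P (quot_proj a)) -> forall u, P u.
Proof. exact: quot_ind. Qed.

End Quotient.

(* A [K]-algebra is a semiring [A] with a homomorphism [iA : K -> A]. *)
Definition algebra_isomorphic (K A B : comPzSemiRingType)
    (iA : {rmorphism K -> A}) (iB : {rmorphism K -> B}) : Prop :=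
  exists2 f : {rmorphism A -> B}, bijective f & forall c, f (iA c) = iB c.

Definition cancellative (S : comPzSemiRingType) : Prop :=
  forall a b c : S, a != 0 -> a * b = a * c -> b = c.

Section Fractions.
Variables (S : comNzSemiRingType) (hS : cancellative S).

Record ratio := Ratio { ratio_val : S * S; ratio_den_neq0 : ratio_val.2 != 0 }.
HB.instance Definition _ := [isSub for ratio_val].
HB.instance Definition _ := [Choice of ratio by <:].

Local Notation num x := (ratio_val x).1.
Local Notation den x := (ratio_val x).2.

Definition frac_rel : rel ratio := fun x y => num x * den y == num y * den x.

Lemma canc_mulf_neq0 (a b : S) : a != 0 -> b != 0 -> a * b != 0.
Proof.
move=> a0; apply: contra_neq => h.
by apply: (hS a0); rewrite h mulr0.
Qed.

Lemma frac_rel_equiv : equiv_class_of frac_rel.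
Proof.
split=> [x|x y|y x z]; rewrite /frac_rel //.
move=> /eqP xy /eqP yz; apply/eqP; apply: (hS (ratio_den_neq0 y)).
transitivity (num x * den y * den z); first by ring.
rewrite xy; transitivity (num y * den z * den x); first by ring.
by rewrite yz; ring.
Qed.

Canonical frac_equiv := EquivRelPack frac_rel_equiv.
Canonical frac_encModRel := defaultEncModRel frac_rel.

Definition frac : Type := {eq_quot frac_rel}.
HB.instance Definition _ : EqQuotient ratio frac_rel frac := EqQuotient.on frac.
HB.instance Definition _ := Choice.on frac.

Lemma fracP (x y : ratio) :
  \pi_frac x = \pi_frac y <-> num x * den y = num y * den x.
Proof.
split=> [/eqmodP/eqP //|h].
by apply/eqmodP/eqP.
Qed.

Lemma frac_repr (x : ratio) :
  num (repr (\pi_frac x)) * den x = num x * den (repr (\pi_frac x)).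
Proof. by apply/fracP; rewrite reprK. Qed.

Lemma frac_ind (P : frac -> Prop) : (forall x, P (\pi_frac x)) -> forall u, P u.
Proof. by move=> h u; rewrite -[u]reprK. Qed.

Definition to_ratio (a : S) : ratio := @Ratio (a, 1) (oner_neq0 S).
Definition add_ratio (x y : ratio) : ratio :=
  @Ratio (num x * den y + num y * den x, den x * den y)
         (canc_mulf_neq0 (ratio_den_neq0 x) (ratio_den_neq0 y)).
Definition mul_ratio (x y : ratio) : ratio :=
  @Ratio (num x * num y, den x * den y)
         (canc_mulf_neq0 (ratio_den_neq0 x) (ratio_den_neq0 y)).

Definition to_frac (a : S) : frac := \pi_frac (to_ratio a).
Definition frac_add (u v : frac) : frac :=
  \pi_frac (add_ratio (repr u) (repr v)).
Definition frac_mul (u v : frac) : frac :=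
  \pi_frac (mul_ratio (repr u) (repr v)).

Lemma frac_addE x y :
  frac_add (\pi_frac x) (\pi_frac y) = \pi_frac (add_ratio x y).
Proof.
apply/fracP => /=; have := frac_repr x; have := frac_repr y.
move: (repr (\pi_frac x)) (repr (\pi_frac y)) => x' y' hy hx.
transitivity ((num x' * den x) * (den y' * den y)
              + (num y' * den y) * (den x' * den x)); first by ring.
by rewrite hx hy; ring.
Qed.

Lemma frac_mulE x y :
  frac_mul (\pi_frac x) (\pi_frac y) = \pi_frac (mul_ratio x y).
Proof. by apply/fracP => /=; rewrite mulrACA !frac_repr mulrACA. Qed.

Lemma frac_addA : associative frac_add.
Proof.
elim/frac_ind=> x; elim/frac_ind=> y; elim/frac_ind=> z; rewrite !frac_addE.
apply/fracP => /=; ring.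
Qed.
Lemma frac_addC : commutative frac_add.
Proof.
elim/frac_ind=> x; elim/frac_ind=> y; rewrite !frac_addE.
by apply/fracP => /=; ring.
Qed.
Lemma frac_add0 : left_id (to_frac 0) frac_add.
Proof. by elim/frac_ind=> x; rewrite frac_addE; apply/fracP => /=; ring. Qed.

HB.instance Definition _ :=
  GRing.isNmodule.Build frac frac_addA frac_addC frac_add0.

Lemma frac_mulA : associative frac_mul.
Proof.
elim/frac_ind=> x; elim/frac_ind=> y; elim/frac_ind=> z; rewrite !frac_mulE.
by apply/fracP => /=; ring.
Qed.
Lemma frac_mulC : commutative frac_mul.
Proof.
elim/frac_ind=> x; elim/frac_ind=> y; rewrite !frac_mulE.
by apply/fracP => /=; ring.
Qed.
Lemma frac_mul1 : left_id (to_frac 1) frac_mul.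
Proof. by elim/frac_ind=> x; rewrite frac_mulE; apply/fracP => /=; ring. Qed.
Lemma frac_mulDl : left_distributive frac_mul frac_add.
Proof.
elim/frac_ind=> x; elim/frac_ind=> y; elim/frac_ind=> z.
by rewrite !(frac_addE, frac_mulE); apply/fracP => /=; ring.
Qed.
Lemma frac_mul0 : left_zero (to_frac 0) frac_mul.
Proof. by elim/frac_ind=> x; rewrite frac_mulE; apply/fracP => /=; ring. Qed.
Lemma frac_one_neq0 : to_frac 1 != 0.
Proof. by apply/eqP => /fracP /= /eqP; rewrite mulr1 mul0r oner_eq0. Qed.

HB.instance Definition _ := GRing.Nmodule_isComNzSemiRing.Build frac
  frac_mulA frac_mulC frac_mul1 frac_mulDl frac_mul0 frac_one_neq0.

Lemma to_frac_nmod : nmod_morphism to_frac.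
Proof.
split=> // a b; rewrite /to_frac.
by rewrite -[RHS]/(frac_add _ _) frac_addE; apply/fracP => /=; ring.
Qed.
Lemma to_frac_monoid : monoid_morphism to_frac.
Proof.
split=> // a b; rewrite /to_frac.
by rewrite -[RHS]/(frac_mul _ _) frac_mulE; apply/fracP => /=; ring.
Qed.

HB.instance Definition _ :=
  GRing.isNmodMorphism.Build S frac to_frac to_frac_nmod.
HB.instance Definition _ :=
  GRing.isMonoidMorphism.Build S frac to_frac to_frac_monoid.

End Fractions.

(* K[X_1, ..., X_n] as the iterated polynomial semiring K[X_1]...[X_n];
   [{mpoly K[n]}] is not available when [K] is only a semiring. *)
Fixpoint mvpoly (K : comNzSemiRingType) (n : nat) : comNzSemiRingType :=
  if n is n'.+1 then {poly (mvpoly K n')} else K.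

Fixpoint mvconst (K : comNzSemiRingType) (n : nat) : {rmorphism K -> mvpoly K n} :=
  match n return {rmorphism K -> mvpoly K n} with
  | 0 => idfun
  | n'.+1 => polyC \o mvconst K n'
  end.

(* The outermost variable of [mvpoly K n.+1] is the last one, so it is
   evaluated at the coordinate [ord_max]. *)
Fixpoint mveval (K : comNzSemiRingType) (n : nat) :
    ('I_n -> K) -> {rmorphism mvpoly K n -> K} :=
  match n return ('I_n -> K) -> {rmorphism mvpoly K n -> K} with
  | 0 => fun _ => idfun
  | n'.+1 => fun x =>
      horner_eval (x ord_max) \o map_poly (mveval (fun i => x (lift ord_max i)))
  end.

Lemma mveval_const (K : comNzSemiRingType) n (x : 'I_n -> K) c :
  mveval x (mvconst K n c) = c.
Proof.
elim: n x => [//|n IHn] x /=.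
by rewrite map_polyC /= /horner_eval hornerC IHn.
Qed.

Section PolynomialFunctions.
Variables (K : comNzSemiRingType) (n : nat).

Definition same_function : set (mvpoly K n * mvpoly K n) :=
  [set pq | forall x : 'I_n -> K, mveval x pq.1 = mveval x pq.2]%classic.

Lemma same_function_cong : is_congruence same_function.
Proof.
split=> [p x //|p q h x|p q r h1 h2 x|p q r s h1 h2 x|p q r s h1 h2 x] /=.
- by rewrite [RHS]h.
- by rewrite [LHS]h1 [LHS]h2.
- by rewrite !rmorphD; congr (_ + _); [exact: h1|exact: h2].
- by rewrite !rmorphM; congr (_ * _); [exact: h1|exact: h2].
Qed.

Definition polyfun : Type := quot (Congruence same_function_cong).
HB.instance Definition _ := GRing.ComPzSemiRing.on polyfun.

Lemma polyfun_one_neq0 : (1 : polyfun) != 0.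
Proof.
apply/eqP => /quot_projP /(_ (fun=> 0)) /= /eqP.
by rewrite rmorph1 rmorph0 oner_eq0.
Qed.
HB.instance Definition _ :=
  GRing.PzSemiRing_isNonZero.Build polyfun polyfun_one_neq0.

Definition polyfun_of : {rmorphism mvpoly K n -> polyfun} :=
  @quot_proj _ (Congruence same_function_cong).

Lemma polyfun_ofP p q :
  polyfun_of p = polyfun_of q <-> forall x, mveval x p = mveval x q.
Proof. exact: quot_projP. Qed.

Lemma polyfunW (P : polyfun -> Prop) :
  (forall p, P (polyfun_of p)) -> forall f, P f.
Proof. exact: quot_projW. Qed.

Definition polyfun_eval (x : 'I_n -> K) (f : polyfun) : K :=
  mveval x (repr (f : quot (Congruence same_function_cong))).

Lemma polyfun_evalE x p : polyfun_eval x (polyfun_of p) = mveval x p.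
Proof. exact: (quot_repr (Congruence same_function_cong) p). Qed.

Lemma polyfun_evalP f g : (forall x, polyfun_eval x f = polyfun_eval x g) -> f = g.
Proof.
elim/polyfunW: f => p; elim/polyfunW: g => q h; apply/polyfun_ofP => x.
by rewrite -!polyfun_evalE.
Qed.

Lemma polyfun_eval_nmod x : nmod_morphism (polyfun_eval x).
Proof.
split; first by rewrite -(rmorph0 polyfun_of) polyfun_evalE rmorph0.
elim/polyfunW=> p; elim/polyfunW=> q.
by rewrite -rmorphD !polyfun_evalE rmorphD.
Qed.
Lemma polyfun_eval_monoid x : monoid_morphism (polyfun_eval x).
Proof.
split; first by rewrite -(rmorph1 polyfun_of) polyfun_evalE rmorph1.
elim/polyfunW=> p; elim/polyfunW=> q.
by rewrite -rmorphM !polyfun_evalE rmorphM.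
Qed.
HB.instance Definition _ x :=
  GRing.isNmodMorphism.Build polyfun K (polyfun_eval x) (polyfun_eval_nmod x).
HB.instance Definition _ x :=
  GRing.isMonoidMorphism.Build polyfun K (polyfun_eval x) (polyfun_eval_monoid x).

End PolynomialFunctions.

(* [None] stands for minus infinity. *)
Definition trop (R : realType) : Type := option R.
Definition tfin {R : realType} (a : R) : trop R := Some a.

Section Trop.
Variable R : realType.
Implicit Types a b c : trop R.

HB.instance Definition _ := Choice.copy (trop R) (option R).

Definition trop_add a b : trop R :=
  match a, b with
  | Some r, Some s => tfin (Num.max r s)
  | Some _, None => a
  | None, _ => b
  end.

Definition trop_mul a b : trop R :=
  if (a, b) is (Some r, Some s) then tfin (r + s) else None.

Definition trop_inv a : trop R := omap (@GRing.opp R) a.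

Lemma trop_addA : associative trop_add.
Proof. by move=> [r|] [s|] [t|] //=; rewrite maxA. Qed.
Lemma trop_addC : commutative trop_add.
Proof. by move=> [r|] [s|] //=; rewrite maxC. Qed.
Lemma trop_add0 : left_id None trop_add.
Proof. by case. Qed.
HB.instance Definition _ :=
  GRing.isNmodule.Build (trop R) trop_addA trop_addC trop_add0.

Lemma trop_mulA : associative trop_mul.
Proof. by move=> [r|] [s|] [t|] //=; rewrite /trop_mul /= addrA. Qed.
Lemma trop_mulC : commutative trop_mul.
Proof. by move=> [r|] [s|] //=; rewrite /trop_mul /= addrC. Qed.
Lemma trop_mul1 : left_id (tfin 0) trop_mul.
Proof. by move=> [r|] //=; rewrite /trop_mul /= add0r. Qed.
Lemma trop_mulDl : left_distributive trop_mul trop_add.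
Proof. by move=> [r|] [s|] [t|] //=; rewrite /trop_mul /= addr_maxl. Qed.
Lemma trop_mul0 : left_zero None trop_mul.
Proof. by []. Qed.
HB.instance Definition _ := GRing.Nmodule_isComNzSemiRing.Build (trop R)
  trop_mulA trop_mulC trop_mul1 trop_mulDl trop_mul0 isT.

Lemma tfinD (r s : R) : tfin r + tfin s = tfin (Num.max r s).
Proof. by []. Qed.
Lemma tfinM (r s : R) : tfin r * tfin s = tfin (r + s).
Proof. by []. Qed.

Lemma trop_add_eq0 a b : a + b = 0 -> a = 0 /\ b = 0.
Proof. by case: a b => [r|] [s|]. Qed.
Lemma trop_mul_eq0 a b : a * b = 0 -> a = 0 \/ b = 0.
Proof. by case: a b => [r|] [s|] //=; [right|left|left]. Qed.
Lemma trop_mulI a b c : a != 0 -> a * b = a * c -> b = c.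
Proof.
case: a b c => [r|] [s|] [t|] //= _ h.
by have [/addrI ->] : tfin (r + s) = tfin (r + t) := h.
Qed.
Lemma trop_mulV b : b != 0 -> b * trop_inv b = 1.
Proof. by case: b => [s|] //= _; rewrite -/(tfin s) tfinM subrr. Qed.
Lemma trop_mul_neq0 a b : a != 0 -> b != 0 -> a * b != 0.
Proof. by case: a b => [r|] [s|]. Qed.
Lemma trop_sum_eq0 k (F : 'I_k -> trop R) :
  \sum_(i < k) F i = 0 -> forall i, F i = 0.
Proof.
elim: k F => [F _ []//|k IHk F]; rewrite big_ord_recr /= => /trop_add_eq0[h1 h2] i.
case: (unliftP ord_max i) => [j ->|-> //].
have -> : lift ord_max j = widen_ord (leqnSn k) j.
  by apply: val_inj; rewrite /= /bump leqNgt ltn_ord.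
exact: (IHk (fun j => F (widen_ord (leqnSn k) j))).
Qed.
Lemma trop_exp_neq0 a k : a != 0 -> a ^+ k != 0.
Proof.
move=> a0; elim: k => [//|k IHk]; rewrite exprS.
by apply/eqP => /trop_mul_eq0[]; apply/eqP.
Qed.

Lemma mveval_eq0 n (x : 'I_n -> trop R) (p : mvpoly (trop R) n) :
  (forall i, x i != 0) -> mveval x p = 0 -> p = 0.
Proof.
elim: n x p => [x p _ //|n IHn x p hx] /=.
rewrite /horner_eval horner_coef => /trop_sum_eq0 h; apply/polyP => i.
rewrite coef0.
have [hi|hi] := ltnP i (size (map_poly (mveval (fun i => x (lift ord_max i))) p)).
  have /trop_mul_eq0 [h0|/eqP h0] := h (Ordinal hi).
    by move: h0; rewrite coef_map => /IHn; apply=> j; apply: hx.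
  by have := trop_exp_neq0 i (hx ord_max); rewrite h0.
apply: (IHn (fun i => x (lift ord_max i))) => [j|]; first exact: hx.
by rewrite -[LHS]coef_map nth_default.
Qed.


(* Convergence of [u] to [a] at infinity, for functions that are eventually
   constant when [a] is real. *)
Definition trop_cvg (u : R -> trop R) a : Prop :=
  if a is Some _ then exists M0, forall M, M0 <= M -> u M = a
  else forall B, exists M0, forall M, M0 <= M -> u M + tfin B = tfin B.

Lemma trop_cvg_unique u a b : trop_cvg u a -> trop_cvg u b -> a = b.
Proof.
have fin_inf r : trop_cvg u (Some r) -> trop_cvg u None -> False.
  move=> [M1 h1] /(_ (r - 1)) [M2 h2].
  have := h2 (Num.max M1 M2); rewrite le_max lexx orbT => /(_ isT).
  rewrite h1 ?le_max ?lexx // -/(tfin r) tfinD => -[/eqP].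
  by rewrite eq_maxr lerBrDr gerDl ler10.
case: a b => [r|] [s|] //.
- move=> [M1 h1] [M2 h2].
  by rewrite -(h1 (Num.max M1 M2)) -?(h2 (Num.max M1 M2)) // le_max lexx ?orbT.
- by move=> h1 h2; case: (fin_inf r).
- by move=> h1 h2; case: (fin_inf s).
Qed.

Lemma trop_cvg_const a : trop_cvg (fun=> a) a.
Proof. by case: a => [r|] /= *; exists 0. Qed.

Lemma trop_cvgD u v a b :
  trop_cvg u a -> trop_cvg v b -> trop_cvg (fun M => u M + v M) (a + b).
Proof.
have fin_inf u' v' r : trop_cvg u' (Some r) -> trop_cvg v' None ->
    trop_cvg (fun M => u' M + v' M) (Some r).
  move=> [M1 h1] /(_ r) [M2 h2]; exists (Num.max M1 M2) => M.
  by rewrite ge_max => /andP[/h1 -> /h2]; rewrite [v' M + _]addrC.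
case: a b => [r|] [s|] hu hv.
- case: hu hv => [M1 h1] [M2 h2]; exists (Num.max M1 M2) => M.
  by rewrite ge_max => /andP[/h1 -> /h2 ->].
- exact: fin_inf hu hv.
- have [M0 h] := fin_inf _ _ _ hv hu.
  by exists M0 => M /h; rewrite addrC.
- move=> B; have [M1 h1] := hu B; have [M2 h2] := hv B.
  exists (Num.max M1 M2) => M.
  by rewrite ge_max => /andP[/h1 e1 /h2 e2]; rewrite -addrA e2 e1.
Qed.

Lemma trop_cvgM u v a b :
  trop_cvg u a -> trop_cvg v b -> trop_cvg (fun M => u M * v M) (a * b).
Proof.
have fin_inf u' v' r : trop_cvg u' (Some r) -> trop_cvg v' None ->
    trop_cvg (fun M => u' M * v' M) None.
  move=> [M1 h1] h2 B; have {h2}[M2 h2] := h2 (B - r).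
  exists (Num.max M1 M2) => M; rewrite ge_max => /andP[/h1 -> /h2].
  move=> /(congr1 (fun c => tfin r * c)).
  by rewrite mulrDr tfinM [r + _]addrC subrK.
case: a b => [r|] [s|] hu hv.
- case: hu hv => [M1 h1] [M2 h2]; exists (Num.max M1 M2) => M.
  by rewrite ge_max => /andP[/h1 -> /h2 ->].
- exact: fin_inf hu hv.
- move=> B; have [M0 h] := fin_inf _ _ _ hv hu B.
  by exists M0 => M /h; rewrite mulrC.
- move=> B; have [M1 h1] := hu B; have [M2 h2] := hv 0.
  exists (Num.max M1 M2) => M; rewrite ge_max => /andP[/h1 + /h2].
  case: (u M) (v M) => [p|] [q|] //.
  rewrite -/(tfin p) -/(tfin q) !tfinD => -[/eqP].
  rewrite eq_maxr => hp [/eqP]; rewrite eq_maxr => hq.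
  by congr tfin; apply/max_idPr; rewrite -[B]addr0 lerD.
Qed.

Lemma trop_cvg_sum k (F : 'I_k -> R -> trop R) (L : 'I_k -> trop R) :
  (forall i, trop_cvg (F i) (L i)) ->
  trop_cvg (fun M => \sum_(i < k) F i M) (\sum_(i < k) L i).
Proof.
move=> h; elim: k F L h => [|k IHk] F L h.
  by under eq_fun do rewrite big_ord0; rewrite big_ord0; apply: trop_cvg_const.
under eq_fun do rewrite big_ord_recr /=; rewrite big_ord_recr /=.
by apply: trop_cvgD => //; apply: IHk.
Qed.

Lemma trop_cvgX u a k : trop_cvg u a -> trop_cvg (fun M => u M ^+ k) (a ^+ k).
Proof.
move=> h; elim: k => [|k IHk]; first exact: trop_cvg_const.
by under eq_fun do rewrite exprS; rewrite exprS; apply: trop_cvgM.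
Qed.

Lemma mveval_coef n (x : 'I_n.+1 -> trop R) (p : mvpoly (trop R) n.+1) :
  mveval x p = \sum_(i < size (p : {poly mvpoly (trop R) n}))
    mveval (fun i => x (lift ord_max i)) (p : {poly mvpoly (trop R) n})`_i
      * x ord_max ^+ i.
Proof.
rewrite /= /horner_eval (@horner_coef_wide _ (size (p : {poly mvpoly (trop R) n}))).
  by apply: eq_bigr => i _; rewrite coef_map.
exact: size_poly.
Qed.

Lemma mveval_cvg n (x : R -> 'I_n -> trop R) (y : 'I_n -> trop R)
    (p : mvpoly (trop R) n) :
  (forall i, trop_cvg (x^~ i) (y i)) ->
  trop_cvg (fun M => mveval (x M) p) (mveval y p).
Proof.
elim: n x y p => [x y p _|n IHn x y p h]; first exact: trop_cvg_const.
under eq_fun do rewrite mveval_coef.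
rewrite mveval_coef; apply: trop_cvg_sum => i.
apply: trop_cvgM; last exact: trop_cvgX.
by apply: IHn => j; apply: h.
Qed.

Lemma mveval_dense n (p q : mvpoly (trop R) n) :
  (forall x : 'I_n -> R, mveval (tfin \o x) p = mveval (tfin \o x) q) ->
  forall x : 'I_n -> trop R, mveval x p = mveval x q.
Proof.
move=> h x; pose y M i := if x i is Some r then r else - M.
have hy i : trop_cvg (fun M => (tfin \o y M) i) (x i).
  rewrite /y /=; case: (x i) => [r|]; first exact: trop_cvg_const.
  move=> B; exists (- B) => M hM; rewrite tfinD; congr tfin.
  by apply/max_idPr; rewrite lerNl.
have hp := mveval_cvg p hy; have hq := mveval_cvg q hy.
by apply: trop_cvg_unique hp _; under eq_fun do rewrite h.
Qed.

Lemma polyfun_tfin_neq0 n (f : polyfun (trop R) n) (x : 'I_n -> R) :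
  f != 0 -> polyfun_eval (tfin \o x) f != 0.
Proof.
elim/polyfunW: f => p; apply: contra_neq; rewrite polyfun_evalE => /mveval_eq0 -> //.
Qed.

Lemma polyfun_cancellative n : cancellative (polyfun (trop R) n).
Proof.
move=> a b c a0 h.
have {a0 h} : forall x : 'I_n -> R,
    polyfun_eval (tfin \o x) b = polyfun_eval (tfin \o x) c.
  move=> x; apply: (trop_mulI (polyfun_tfin_neq0 x a0)).
  by rewrite -!rmorphM h.
elim/polyfunW: b => p; elim/polyfunW: c => q h.
by apply/polyfun_ofP/mveval_dense => x; rewrite -!polyfun_evalE.
Qed.

End Trop.

Section TropicalRationalFunctions.
Variables (R : realType) (n : nat).

Definition tropfrac : Type := frac (@polyfun_cancellative R n).
HB.instance Definition _ := GRing.ComNzSemiRing.on tropfrac.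

Definition tropfrac_of : {rmorphism polyfun (trop R) n -> tropfrac} :=
  to_frac (@polyfun_cancellative R n).

Definition tropfrac_const : {rmorphism trop R -> tropfrac} :=
  tropfrac_of \o (polyfun_of (trop R) n \o mvconst (trop R) n).

(* The denominator takes a real value at a real point, so [trop_inv] is never
   applied to minus infinity here; by [tropfrac_evalE] the value does not
   depend on the chosen fraction. *)
Definition tropfrac_eval (x : 'rV[R]_n) (f : tropfrac) : trop R :=
  let r := ratio_val (repr (f : frac (@polyfun_cancellative R n))) in
  polyfun_eval (fun i => tfin (x 0 i)) r.1
    * trop_inv (polyfun_eval (fun i => tfin (x 0 i)) r.2).

Lemma tropfracW (P : tropfrac -> Prop) :
  (forall r, P (\pi_(frac (@polyfun_cancellative R n)) r)) -> forall f, P f.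
Proof. exact: frac_ind. Qed.

Lemma tropfrac_evalE x r :
  tropfrac_eval x (\pi_(frac (@polyfun_cancellative R n)) r) =
  polyfun_eval (fun i => tfin (x 0 i)) (ratio_val r).1
    * trop_inv (polyfun_eval (fun i => tfin (x 0 i)) (ratio_val r).2).
Proof.
rewrite /tropfrac_eval; have := frac_repr (@polyfun_cancellative R n) r; set s := repr _.
move=> /(congr1 (polyfun_eval (fun i => tfin (x 0 i)))); rewrite !rmorphM.
set e := polyfun_eval _ => h.
have e0 t : e (ratio_val t).2 != 0 by apply: polyfun_tfin_neq0 (ratio_den_neq0 t).
apply: (trop_mulI (e0 r)); apply: (trop_mulI (e0 s)).
transitivity (e (ratio_val s).1 * e (ratio_val r).2
              * (e (ratio_val s).2 * trop_inv (e (ratio_val s).2))); first by ring.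
rewrite h trop_mulV // -(trop_mulV (e0 r)); ring.
Qed.

Lemma tropfrac_eval_of x f :
  tropfrac_eval x (tropfrac_of f) = polyfun_eval (fun i => tfin (x 0 i)) f.
Proof.
by rewrite tropfrac_evalE /= rmorph1 -[trop_inv 1]mul1r trop_mulV ?mulr1 ?oner_neq0.
Qed.

Lemma tropfrac_eval_const x c : tropfrac_eval x (tropfrac_const c) = c.
Proof. by rewrite tropfrac_eval_of polyfun_evalE mveval_const. Qed.

Lemma tropfrac_eval_nmod x : nmod_morphism (tropfrac_eval x).
Proof.
split; first by rewrite -(rmorph0 tropfrac_of) tropfrac_eval_of rmorph0.
elim/tropfracW=> r; elim/tropfracW=> s.
rewrite -[X in tropfrac_eval x X]/(frac_add _ _) frac_addE !tropfrac_evalE /=.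
rewrite !(rmorphD, rmorphM) /=; set e := polyfun_eval _.
have e0 t : e (ratio_val t).2 != 0 by apply: polyfun_tfin_neq0 (ratio_den_neq0 t).
apply: (trop_mulI (trop_mul_neq0 (e0 r) (e0 s))).
rewrite mulrCA trop_mulV ?trop_mul_neq0 // mulr1.
transitivity (e (ratio_val r).1 * e (ratio_val s).2
                * (e (ratio_val r).2 * trop_inv (e (ratio_val r).2))
              + e (ratio_val s).1 * e (ratio_val r).2
                * (e (ratio_val s).2 * trop_inv (e (ratio_val s).2))); last by ring.
by rewrite !trop_mulV // !mulr1.
Qed.

Lemma tropfrac_eval_monoid x : monoid_morphism (tropfrac_eval x).
Proof.
split; first by rewrite -(rmorph1 tropfrac_of) tropfrac_eval_of rmorph1.
elim/tropfracW=> r; elim/tropfracW=> s.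
rewrite -[X in tropfrac_eval x X]/(frac_mul _ _) frac_mulE !tropfrac_evalE /=.
rewrite !rmorphM /=; set e := polyfun_eval _.
have e0 t : e (ratio_val t).2 != 0 by apply: polyfun_tfin_neq0 (ratio_den_neq0 t).
apply: (trop_mulI (trop_mul_neq0 (e0 r) (e0 s))).
rewrite mulrCA trop_mulV ?trop_mul_neq0 // mulr1.
transitivity (e (ratio_val r).1 * e (ratio_val s).1
                * (e (ratio_val r).2 * trop_inv (e (ratio_val r).2))
                * (e (ratio_val s).2 * trop_inv (e (ratio_val s).2))); last by ring.
by rewrite !trop_mulV // !mulr1.
Qed.

HB.instance Definition _ x := GRing.isNmodMorphism.Build tropfrac (trop R)
  (tropfrac_eval x) (tropfrac_eval_nmod x).
HB.instance Definition _ x := GRing.isMonoidMorphism.Build tropfrac (trop R)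
  (tropfrac_eval x) (tropfrac_eval_monoid x).

Section CongruenceOfSubset.
Variable V : set 'rV[R]_n.

Definition agree_on : set (tropfrac * tropfrac) :=
  [set fg | forall x, V x -> tropfrac_eval x fg.1 = tropfrac_eval x fg.2]%classic.

Lemma agree_on_cong : is_congruence agree_on.
Proof.
split=> [f x //|f g h x Vx|f g k h1 h2 x Vx
        |f g k l h1 h2 x Vx|f g k l h1 h2 x Vx] /=.
- by rewrite [RHS]h.
- by rewrite [LHS]h1 // [LHS]h2.
- by rewrite !rmorphD; congr (_ + _); [exact: h1|exact: h2].
- by rewrite !rmorphM; congr (_ * _); [exact: h1|exact: h2].
Qed.

Definition Econg : congruence tropfrac := Congruence agree_on_cong.

Definition Equot_const : {rmorphism trop R -> quot Econg} :=
  quot_proj Econg \o tropfrac_const.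

End CongruenceOfSubset.
End TropicalRationalFunctions.

(* Main.v *)
Require Import Defs.
From HB Require Import structures.
From mathcomp Require Import all_boot all_order all_algebra.
From mathcomp Require Import boolp classical_sets cardinality reals.
From mathcomp Require Import ring.

(** Being finitely generated is independent of the presentation because the
    rational function semifields behave like free objects. An element of
    T(X_1, ..., X_n) is determined by its values at the points of R^n, so for
    nonzero h_1, ..., h_n in T(Y_1, ..., Y_m) the substitution X_i |-> h_i is a
    well defined homomorphism of T-algebras ([substitution_exists]): it is the
    precomposition with the map R^m -> R^n with coordinates h_i. Hence an
    isomorphism phi : T(X)/E(V) -> T(Y)/E(W) lifts to a homomorphism
    Phi : T(X) -> T(Y), and its inverse lifts to Psi : T(Y) -> T(X)
    ([lift_exists]).

    If a finite set F generates E(V), then the images under Phi of the pairs of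
    F together with the m pairs (Y_j, Phi (Psi Y_j)) generate E(W). They lie in
    E(W), as Phi and Psi lift mutually inverse maps. Conversely, let C be a
    congruence containing them. The preimage of C under Phi is a
    congruence containing F, hence E(V); thus, for (u, v) in E(W), the pair
    (Psi u, Psi v) lies in E(V) and (Phi (Psi u), Phi (Psi v)) lies in C.
    Moreover u and Phi (Psi u) are congruent modulo C for every u, because this
    holds for constants and for variables, and T(Y) is generated by those as a
    semifield ([tropfrac_gen_ind]); so (u, v) is in C
    ([finitely_generated_transfer]). *)

Set Implicit Arguments.
Unset Strict Implicit.
Unset Printing Implicit Defensive.

Import GRing.Theory.
Local Open Scope ring_scope.
Local Open Scope quotient_scope.
Local Open Scope classical_set_scope.

(** * Congruences *)

Lemma cong_preimage (A B : comPzSemiRingType) (f : {rmorphism A -> B})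
    (C : set (B * B)) :
  is_congruence C -> is_congruence [set ab | C (f ab.1, f ab.2)].
Proof.
move=> hC; split=> [a|a b|a b c|a b c d|a b c d] /=.
- exact: cong_refl.
- exact: cong_sym.
- exact: cong_trans.
- by rewrite !rmorphD; exact: congD.
- by rewrite !rmorphM; exact: congM.
Qed.

(** Multiply the relation between [a] and [c] by [b * d]. *)
Lemma cong_inv (A : comPzSemiRingType) (C : set (A * A)) (a b c d : A) :
  is_congruence C -> a * b = 1 -> c * d = 1 -> C (a, c) -> C (b, d).
Proof.
move=> hC ab cd /(cong_sym hC) hca.
have := congM hC hca (cong_refl hC (b * d)).
by rewrite mulrCA cd mulr1 mulrA ab mul1r.
Qed.

(** The abstract form of the argument: [G] is a finite set of elements on which
    it suffices to test that [Phi \o Psi] is the identity modulo a congruence. *)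
Lemma finitely_generated_transfer (A B : comPzSemiRingType)
    (E : set (A * A)) (E' : set (B * B))
    (Phi : {rmorphism A -> B}) (Psi : {rmorphism B -> A}) (G : set B) :
    is_congruence E' ->
    (forall a b, E (a, b) -> E' (Phi a, Phi b)) ->
    (forall a b, E' (a, b) -> E (Psi a, Psi b)) ->
    (forall u, E' (u, Phi (Psi u))) ->
    finite_set G ->
    (forall C, is_congruence C -> (forall u, G u -> C (u, Phi (Psi u))) ->
       forall u, C (u, Phi (Psi u))) ->
  finitely_generated E -> finitely_generated E'.
Proof.
move=> hE' EE' E'E hPP finG hG [F [finF FE defE]].
pose F' := [set (Phi ab.1, Phi ab.2) | ab in F]
             `|` [set (u, Phi (Psi u)) | u in G].
have F'E' : F' `<=` E'.
  by move=> _ [[[a b] /FE /EE' hab <-]|[u _ <-]].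
exists F'; split=> //.
  by rewrite finite_setU; split; apply: finite_image.
apply/seteqP; split=> [[u v] uv C [hC F'C]|uv]; last exact.
have idC w : C (w, Phi (Psi w)).
  by apply: (hG C hC) => t Gt; apply: (F'C (t, _)); right; exists t.
suff PPuv : C (Phi (Psi u), Phi (Psi v)).
  apply: (cong_trans hC (idC u)); apply: (cong_trans hC PPuv).
  exact: cong_sym (idC v).
have : E (Psi u, Psi v) by exact: E'E.
rewrite defE => /(_ [set ab | C (Phi ab.1, Phi ab.2)]); apply.
split; first exact: cong_preimage hC.
by move=> ab Fab; apply: F'C; left; exists ab.
Qed.

(** * Generators of the rational function semifield *)

Fixpoint mvvar (K : comNzSemiRingType) (n : nat) : 'I_n -> mvpoly K n :=
  match n return 'I_n -> mvpoly K n with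
  | 0 => fun _ => 0
  | n'.+1 => fun i => if unlift ord_max i is Some j then (mvvar K j)%:P else 'X
  end.

Lemma mveval_var (K : comNzSemiRingType) n (x : 'I_n -> K) i :
  mveval x (mvvar K i) = x i.
Proof.
elim: n x i => [x []//|n IHn] x i /=; rewrite /horner_eval.
case: unliftP => [j ->|->]; first by rewrite map_polyC hornerC; exact: IHn.
by rewrite map_polyX hornerX.
Qed.

Lemma mvpoly_ind (K : comNzSemiRingType) n (P : mvpoly K n -> Prop) :
    (forall c, P (mvconst K n c)) -> (forall i, P (mvvar K i)) ->
    (forall p q, P p -> P q -> P (p + q)) ->
    (forall p q, P p -> P q -> P (p * q)) ->
  forall p, P p.
Proof.
elim: n P => [|n IHn] P Pc Pv PD PM p; first exact: Pc.
have PC q : P q%:P.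
  apply: (IHn (fun q => P q%:P)) => [c|i|p1 p2|p1 p2].
  - exact: Pc.
  - by have := Pv (lift ord_max i); rewrite /= liftK.
  - by rewrite polyCD; exact: PD.
  - by rewrite polyCM; exact: PM.
have PX : P ('X : {poly mvpoly K n}).
  by have := Pv ord_max; rewrite /= unlift_none.
by elim/poly_ind: (p : {poly mvpoly K n}) => [|q c Pq];
  [rewrite -polyC0; exact: PC | apply: PD (PC c); exact: PM].
Qed.

Lemma trop_div_eq (R : realType) (a b c d : trop R) :
  b != 0 -> d != 0 -> a * trop_inv b = c * trop_inv d -> a * d = c * b.
Proof.
move=> /trop_mulV hb /trop_mulV hd h.
transitivity (a * trop_inv b * (b * d)).
  by rewrite -[LHS]mulr1 -hb; ring.
by rewrite h -[RHS]mulr1 -hd; ring.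
Qed.

Section TropfracGenerators.
Variables (R : realType) (n : nat).
Implicit Types f g : tropfrac R n.

Definition tropfrac_var (i : 'I_n) : tropfrac R n :=
  tropfrac_of R n (polyfun_of (trop R) n (mvvar (trop R) i)).

Lemma tropfrac_eval_var x i :
  tropfrac_eval x (tropfrac_var i) = tfin (x 0 i).
Proof. by rewrite tropfrac_eval_of polyfun_evalE mveval_var. Qed.

Lemma tropfrac_eval_inj f g :
  (forall x, tropfrac_eval x f = tropfrac_eval x g) -> f = g.
Proof.
elim/tropfracW: f => r; elim/tropfracW: g => s rs; apply/fracP.
move: r s rs => [[a b] /= b0] [[c d] /= d0] rs.
have {rs} : forall x : 'I_n -> R,
    polyfun_eval (tfin \o x) (a * d) = polyfun_eval (tfin \o x) (c * b).
  move=> x; have := rs (\row_i x i); rewrite !tropfrac_evalE /=.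
  have -> : (fun i => tfin ((\row_i x i) 0 i)) = tfin \o x.
    by apply: funext => i /=; rewrite mxE.
  rewrite !rmorphM; apply: trop_div_eq; exact: polyfun_tfin_neq0.
move: (a * d) (c * b); elim/polyfunW=> p; elim/polyfunW=> q h.
by apply/polyfun_ofP/mveval_dense => x; rewrite -!polyfun_evalE.
Qed.

Lemma tropfrac_invertible f : f != 0 -> exists g, f * g = 1.
Proof.
elim/tropfracW: f => -[[a b] /= b0] f0.
have a0 : a != 0.
  apply: contra_neq f0 => a0; apply/fracP => /=.
  by rewrite a0 !mul0r.
exists (\pi_(Defs.frac (@polyfun_cancellative R n)) (@Defs.Ratio _ (b, a) a0)).
rewrite -[LHS]/(frac_mul _ _) frac_mulE; apply/fracP => /=.
by rewrite mulr1 mul1r mulrC.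
Qed.

Lemma tropfrac_eval_neq0 x f : f != 0 -> tropfrac_eval x f != 0.
Proof.
move=> /tropfrac_invertible[g fg]; apply/eqP => f0.
have := congr1 (tropfrac_eval x) fg; rewrite rmorphM rmorph1 /= f0 mul0r.
by move/eqP; rewrite eq_sym oner_eq0.
Qed.

Lemma tropfrac_var_neq0 i : tropfrac_var i != 0.
Proof.
apply/eqP => /(congr1 (tropfrac_eval 0)).
by rewrite tropfrac_eval_var rmorph0.
Qed.

(** The semifield is generated by the constants and the variables: a fraction
    is the product of a polynomial function and of the inverse of another. *)
Lemma tropfrac_gen_ind (P : tropfrac R n -> Prop) :
    (forall c, P (tropfrac_const R n c)) -> (forall i, P (tropfrac_var i)) ->
    (forall f g, P f -> P g -> P (f + g)) ->
    (forall f g, P f -> P g -> P (f * g)) ->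
    (forall f g, f * g = 1 -> P f -> P g) ->
  forall f, P f.
Proof.
move=> Pc Pv PD PM PV.
have Pof p : P (tropfrac_of R n p).
  elim/polyfunW: p => p; elim/mvpoly_ind: p => [c|i|p q|p q].
  - exact: Pc.
  - exact: Pv.
  - by rewrite !rmorphD; exact: PD.
  - by rewrite !rmorphM; exact: PM.
elim/tropfracW=> -[[a b] /= b0].
pose binv : tropfrac R n :=
  \pi_(Defs.frac (@polyfun_cancellative R n)) (@Defs.Ratio _ (1, b) b0).
have -> : \pi_(Defs.frac (@polyfun_cancellative R n)) (@Defs.Ratio _ (a, b) b0)
          = tropfrac_of R n a * binv :> tropfrac R n.
  rewrite -[RHS]/(frac_mul _ _) frac_mulE; apply/fracP => /=.
  by rewrite mulr1 mul1r.
apply: PM (Pof a) _; apply: PV (Pof b).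
rewrite -[LHS]/(frac_mul _ _) frac_mulE; apply/fracP => /=.
by rewrite !mulr1 !mul1r.
Qed.

Lemma tropfrac_rmorph_cong (B : comPzSemiRingType) (C : set (B * B))
    (f g : {rmorphism tropfrac R n -> B}) :
    is_congruence C ->
    (forall c, C (f (tropfrac_const R n c), g (tropfrac_const R n c))) ->
    (forall i, C (f (tropfrac_var i), g (tropfrac_var i))) ->
  forall u, C (f u, g u).
Proof.
move=> hC Cc Cv; apply: tropfrac_gen_ind => // [a b|a b|a b ab].
- by rewrite !rmorphD; exact: congD.
- by rewrite !rmorphM; exact: congM.
- by apply: cong_inv => //; rewrite -rmorphM ab rmorph1.
Qed.

End TropfracGenerators.

(** * Substitutions and lifts of homomorphisms *)

(** The substitution is the precomposition with the point map [y |-> (h_i y)_i].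
    That [f] composed with it is again a rational function holds on generators
    and passes to sums, products and inverses; uniqueness of the element with
    these values makes the choice a homomorphism. *)
Lemma substitution_exists (R : realType) n m (h : 'I_n -> tropfrac R m) :
    (forall i, h i != 0) ->
  exists Phi : {rmorphism tropfrac R n -> tropfrac R m},
    (forall c, Phi (tropfrac_const R n c) = tropfrac_const R m c) /\
    (forall i, Phi (tropfrac_var R i) = h i).
Proof.
move=> h0.
(* The default value 0 is never taken, since each [h i] is finite everywhere. *)
pose H (y : 'rV[R]_m) : 'rV[R]_n := \row_i odflt 0 (tropfrac_eval y (h i)).
have HE y i : tfin (H y 0 i) = tropfrac_eval y (h i).
  by rewrite mxE; have := tropfrac_eval_neq0 y (h0 i); case: (tropfrac_eval _ _).
have comp_ex f : exists g : tropfrac R m,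
    forall y, tropfrac_eval y g = tropfrac_eval (H y) f.
  elim/tropfrac_gen_ind: f => [c|i|f1 f2 [g1 e1] [g2 e2]|f1 f2 [g1 e1] [g2 e2]
                              |f1 f2 f12 [g1 e1]].
  - by exists (tropfrac_const R m c) => y; rewrite !tropfrac_eval_const.
  - by exists (h i) => y; rewrite tropfrac_eval_var HE.
  - by exists (g1 + g2) => y; rewrite !rmorphD /= e1 e2.
  - by exists (g1 * g2) => y; rewrite !rmorphM /= e1 e2.
  - have f12E y : tropfrac_eval (H y) f1 * tropfrac_eval (H y) f2 = 1.
      by rewrite -rmorphM f12 rmorph1.
    have g10 : g1 != 0.
      apply/eqP => g10; have := f12E 0; rewrite -e1 g10 rmorph0 mul0r.
      by move/eqP; rewrite eq_sym oner_eq0.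
    have [g2 g12] := tropfrac_invertible g10; exists g2 => y.
    apply: (trop_mulI (tropfrac_eval_neq0 y g10)).
    by rewrite -rmorphM g12 rmorph1 e1 f12E.
have [phi phiE] := choice comp_ex.
have phi_nmod : nmod_morphism phi.
  split=> [|f g]; apply: tropfrac_eval_inj => y; first by rewrite phiE !rmorph0.
  by rewrite rmorphD /= !phiE rmorphD.
have phi_monoid : monoid_morphism phi.
  split=> [|f g]; apply: tropfrac_eval_inj => y; first by rewrite phiE !rmorph1.
  by rewrite rmorphM /= !phiE rmorphM.
pose phiN := GRing.isNmodMorphism.Build _ _ phi phi_nmod.
pose phiM := GRing.isMonoidMorphism.Build _ _ phi phi_monoid.
pose Phi : {rmorphism tropfrac R n -> tropfrac R m} :=
  HB.pack phi phiN phiM.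
exists Phi; split=> [c|i]; apply: tropfrac_eval_inj => y; rewrite /= phiE.
  by rewrite !tropfrac_eval_const.
by rewrite tropfrac_eval_var HE.
Qed.

(** The class of [0] is a unit only in the zero semiring, which occurs for
    empty [W]; there [1] represents it as well. *)
Lemma unit_repr_neq0 (R : realType) m (W : set 'rV[R]_m)
    (u v : quot (Econg W)) :
  u * v = 1 -> exists2 h, h != 0 & quot_proj (Econg W) h = u.
Proof.
move=> uv; elim/quot_projW: u uv => h uv.
have [h0|h0] := eqVneq h 0; last by exists h.
exists 1; first exact: oner_neq0.
by rewrite rmorph1 -uv h0 rmorph0 mul0r.
Qed.

Lemma lift_exists (R : realType) n m (V : set 'rV[R]_n) (W : set 'rV[R]_m)
    (phi : {rmorphism quot (Econg V) -> quot (Econg W)}) :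
    (forall c, phi (Equot_const V c) = Equot_const W c) ->
  exists Phi : {rmorphism tropfrac R n -> tropfrac R m},
    (forall c, Phi (tropfrac_const R n c) = tropfrac_const R m c) /\
    (forall f, quot_proj (Econg W) (Phi f) = phi (quot_proj (Econg V) f)).
Proof.
move=> phic.
have h_ex i : exists h : tropfrac R m, h != 0 /\
    quot_proj (Econg W) h = phi (quot_proj (Econg V) (tropfrac_var R i)).
  have [g xg] := tropfrac_invertible (tropfrac_var_neq0 R i).
  have [|h h0 hE] := @unit_repr_neq0 R m W
      (phi (quot_proj (Econg V) (tropfrac_var R i)))
      (phi (quot_proj (Econg V) g)).
    by rewrite -!rmorphM xg !rmorph1.
  by exists h.
have [h hP] := choice h_ex.
have [Phi [Phic Phiv]] := substitution_exists (fun i => (hP i).1).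
exists Phi; split=> // f.
have eq_cong : is_congruence
    [set uv : quot (Econg W) * quot (Econg W) | uv.1 = uv.2].
  by split=> //= [a b c -> //|a b c d -> -> //|a b c d -> -> //].
apply: (tropfrac_rmorph_cong (f := quot_proj (Econg W) \o Phi)
          (g := phi \o quot_proj (Econg V)) eq_cong) => [c|i] /=.
  by rewrite Phic; exact/esym/phic.
by rewrite Phiv (hP i).2.
Qed.

(** * Invariance of finite generation *)

Lemma algebra_isomorphic_inverse (K A B : comPzSemiRingType)
    (iA : {rmorphism K -> A}) (iB : {rmorphism K -> B}) :
    algebra_isomorphic iA iB ->
  exists (f : {rmorphism A -> B}) (g : {rmorphism B -> A}),
    [/\ cancel f g, cancel g f,
        forall c, f (iA c) = iB c & forall c, g (iB c) = iA c].
Proof.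
move=> [f [g fK gK] fi].
have g_nmod : nmod_morphism g.
  by split=> [|a b]; apply: (can_inj fK);
    rewrite gK ?rmorph0 // rmorphD !gK.
have g_monoid : monoid_morphism g.
  by split=> [|a b]; apply: (can_inj fK);
    rewrite gK ?rmorph1 // rmorphM !gK.
pose gN := GRing.isNmodMorphism.Build _ _ g g_nmod.
pose gM := GRing.isMonoidMorphism.Build _ _ g g_monoid.
pose g' : {rmorphism B -> A} := HB.pack g gN gM.
by exists f, g'; split=> // c; rewrite /= -fi fK.
Qed.

(** A section [psi] of [phi] is enough: it makes the quotient by [E(W)] a
    retract of the quotient by [E(V)]. *)
Lemma finitely_generated_retract (R : realType) n m
    (V : set 'rV[R]_n) (W : set 'rV[R]_m)
    (phi : {rmorphism quot (Econg V) -> quot (Econg W)})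
    (psi : {rmorphism quot (Econg W) -> quot (Econg V)}) :
    cancel psi phi ->
    (forall c, phi (Equot_const V c) = Equot_const W c) ->
    (forall c, psi (Equot_const W c) = Equot_const V c) ->
  finitely_generated (Econg V) -> finitely_generated (Econg W).
Proof.
move=> psiK phic psic.
have [Phi [Phic PhiE]] := lift_exists phic.
have [Psi [Psic PsiE]] := lift_exists psic.
apply: (@finitely_generated_transfer _ _ _ _ Phi Psi
          (range (@tropfrac_var R m))).
- exact: congruenceP.
- by move=> a b /quot_projP ab; apply/quot_projP; rewrite !PhiE ab.
- by move=> a b /quot_projP ab; apply/quot_projP; rewrite !PsiE ab.
- by move=> u; apply/quot_projP; rewrite PhiE PsiE psiK.
- exact: finite_image.
- move=> C hC Cvar u.
  apply: (tropfrac_rmorph_cong (f := idfun) (g := Phi \o Psi) hC) => [c|i] /=.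
    by rewrite Psic Phic; exact: cong_refl.
  by apply: Cvar; exists i.
Qed.

Theorem corollary1p3 (R : realType) (n m : nat)
    (V : set 'rV[R]_n) (W : set 'rV[R]_m) :
  algebra_isomorphic (Equot_const V) (Equot_const W) ->
  (finitely_generated (Econg V) <-> finitely_generated (Econg W)).
Proof.
move=> /algebra_isomorphic_inverse[f [g [fK gK fi gi]]].
by split; [exact: (finitely_generated_retract gK)
          |exact: (finitely_generated_retract fK)].
Qed.
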